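(* Let $\ell\ge2$, let $(g;f_1,\ldots,f_\ell)$ be an $\ell$-multiple Riordan array over $\mathbb R$, and let $(\hat g;\hat f_1,\hat f_2,\ldots,\hat f_\ell)$ be its compression. If $\hat g$ and $\hat f_i$, $i=1,2,\ldots,\ell$, are P\'olya frequency formal power series, then the infinite matrix $(\hat g;\hat f_1,\hat f_2,\ldots,\hat f_\ell)$ is totally positive.
   Context: An $\ell$-multiple Riordan array $(g;f_1,\ldots,f_\ell)=(d_{n,k})_{n,k\ge0}$ over $\mathbb R$ is given by $g(t)=\sum_{k\ge0}g_kt^{k\ell}$ with $g_0\ne0$ and $f_i(t)=\sum_{k\ge0}f_{i,k}t^{k\ell+1}$ with $f_{i,0}\neq0$ ($i=1,\ldots,\ell$); its entries are $$d_{n,k}=[t^n]\,g\,f_1^{\lfloor (k+\ell-1)/\ell\rfloor}f_2^{\lfloor (k+\ell-2)/\ell\rfloor}\cdots f_\ell^{\lfloor k/\ell\rfloor}.$$ Put $\hat g(t)=\sum_{k\ge0}g_kt^k$ and $\hat f_i(t)=\sum_{k\ge0}f_{i,k}t^{k+1}$. The compression is the lower triangular matrix $(\hat g;\hat f_1,\ldots,\hat f_\ell)=(\hat d_{n,k})_{n,k\ge0}$ with $\hat d_{n,k}=d_{n\ell-(\ell-1)k,\,k}$ for $n\ge k\ge0$ and $\hat d_{n,k}=0$ for $k>n$; equivalently, $\hat d_{n,k}=[t^n]\,\hat g\,\hat f_1^{\lfloor (k+\ell-1)/\ell\rfloor}\hat f_2^{\lfloor (k+\ell-2)/\ell\rfloor}\cdots\hat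 f_\ell^{\lfloor k/\ell\rfloor}$. An infinite matrix is totally positive if its minors of all (finite) orders are nonnegative. A nonnegative sequence $(a_n)_{n\ge0}$ is a P\'olya frequency sequence if its Toeplitz matrix $[a_{i-j}]_{i,j\ge0}$ (with $a_n=0$ for $n<0$) is totally positive; in that case $\sum_{n\ge0}a_nt^n$ is called a P\'olya frequency formal power series. *)

(* Defs.v *)
From HB Require Import structures.
From mathcomp Require Import all_boot all_order all_algebra.
From mathcomp Require Import reals.

Set Implicit Arguments.
Unset Strict Implicit.
Unset Printing Implicit Defensive.

Import Order.TTheory GRing.Theory Num.Theory.
Local Open Scope ring_scope.

(* The formal power series \sum_n a_n t^n is its coefficient sequence, so
   that [t^n] a is the application a n. *)
Definition fps (R : realType) := nat -> R.

Definition fps_one (R : realType) : fps R := fun n => (n == 0%N)%:R.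

Definition fps_mul (R : realType) (a b : fps R) : fps R :=
  fun n => \sum_(i < n.+1) a i * b (n - i)%N.

Definition fps_exp (R : realType) (a : fps R) (m : nat) : fps R :=
  iter m (fps_mul a) (fps_one R).

Definition infmx (R : realType) := nat -> nat -> R.

(* Here (f 0, ..., f (l - 1)) stands for (f_1, ..., f_l): the index is shifted
   by one.  The conditions say that g is a power series in t^l with nonzero
   constant term, and that each f_i is t times such a series. *)
Definition multiple_riordan (R : realType) (l : nat)
    (g : fps R) (f : 'I_l -> fps R) : Prop :=
  [/\ g 0%N != 0,
      forall n, ~~ (l %| n)%N -> g n = 0,
      forall i, f i 1%N != 0
    & forall i n, n != 1 %[mod l] -> f i n = 0].

(* Because of the index shift, the exponent floor((k + l - i) / l) of f_i
   becomes (k + l - i.+1) %/ l. *)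
Definition riordan_entry (R : realType) (l : nat)
    (g : fps R) (f : 'I_l -> fps R) : infmx R :=
  fun n k =>
    fps_mul g
      (\big[@fps_mul R/fps_one R]_(i < l)
          fps_exp (f i) ((k + l - i.+1) %/ l)) n.

(* g = \sum_k g_k t^(k l)  gives  \sum_k g_k t^k *)
Definition compress_g (R : realType) (l : nat) (g : fps R) : fps R :=
  fun k => g (k * l)%N.

(* f = \sum_k f_k t^(k l + 1)  gives  \sum_k f_k t^(k + 1) *)
Definition compress_f (R : realType) (l : nat) (f : fps R) : fps R :=
  fun n => if n is k.+1 then f (k * l + 1)%N else 0.

(* For k <= n and l > 0 the subtraction below is not truncated. *)
Definition compression (R : realType) (l : nat)
    (g : fps R) (f : 'I_l -> fps R) : infmx R :=
  fun n k =>
    if (k <= n)%N then riordan_entry g f (n * l - (l - 1) * k)%N k else 0.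

Definition totally_positive (R : realType) (A : infmx R) : Prop :=
  forall (m : nat) (r c : 'I_m -> nat),
    {homo r : i j / (i < j)%N} -> {homo c : i j / (i < j)%N} ->
    0 <= \det (\matrix_(i < m, j < m) A (r i) (c j)).

Definition toeplitz (R : realType) (a : nat -> R) : infmx R :=
  fun i j => if (j <= i)%N then a (i - j)%N else 0.

Definition polya_frequency (R : realType) (a : fps R) : Prop :=
  (forall n, 0 <= a n) /\ totally_positive (toeplitz a).

(* Main.v *)
(* Write f_i = t h_i after compression, and extend (h_s) periodically.  Column k
   of the compression is then t^k g h_0 ... h_(k-1), so the compression is the
   Toeplitz matrix of g times the matrix P(h) with columns t^k h_0 ... h_(k-1).
   Pulling h_0 out of all columns but the first gives
     P(h_0, h_1, ...) = 1 (+) Toeplitz(h_0) P(h_1, h_2, ...),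
   and by Cauchy-Binet total positivity of the minors with rows below N follows
   by induction on N. *)

Require Import Defs.
From mathcomp Require Import all_boot all_order all_algebra.
From mathcomp Require Import all_fingroup boolp reals.
From HB Require Import structures.

Set Implicit Arguments.
Unset Strict Implicit.
Unset Printing Implicit Defensive.

Import Order.TTheory GRing.Theory Num.Theory.
Local Open Scope ring_scope.

(** * The Cauchy-Binet formula *)

Lemma det_colsub_perm (R : comPzRingType) m n (A : 'M[R]_(m, n)) (f : 'I_m -> 'I_n)
    (s : 'S_m) :
  \det (colsub (f \o s) A) = (-1) ^+ s * \det (colsub f A).
Proof.
have -> : colsub (f \o s) A = col_perm s (colsub f A).
  by apply/matrixP => i j; rewrite !mxE.
by rewrite col_permE det_mulmx det_perm odd_permV mulrC.
Qed.

Lemma det_rowsub_perm (R : comPzRingType) m n (B : 'M[R]_(n, m)) (f : 'I_m -> 'I_n)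
    (s : 'S_m) :
  \det (rowsub (f \o s) B) = (-1) ^+ s * \det (rowsub f B).
Proof.
have tr_rowsub g : (rowsub g B)^T = colsub g B^T.
  by apply/matrixP => i j; rewrite !mxE.
by rewrite -[LHS]det_tr -[\det (rowsub f B)]det_tr !tr_rowsub det_colsub_perm.
Qed.

(* Symmetrizing the selection f over permutations avoids having to choose an
   increasing representative; this accounts for the factor m!. *)
Lemma Cauchy_Binet_factorial (R : comPzRingType) m n (A : 'M[R]_(m, n))
    (B : 'M[R]_(n, m)) :
  \det (A *m B) *+ m`! =
    \sum_(f : {ffun 'I_m -> 'I_n}) \det (colsub f A) * \det (rowsub f B).
Proof.
have detAB : \det (A *m B) =
    \sum_(f : {ffun 'I_m -> 'I_n}) (\prod_i A i (f i)) * \det (rowsub f B).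
  transitivity (\sum_(f : {ffun 'I_m -> 'I_n}) \sum_(s : 'S_m)
      (-1) ^+ s * \prod_i (A i (f i) * B (f i) (s i))).
    rewrite exchange_big; apply: eq_bigr => /= s _; rewrite -big_distrr /=.
    congr (_ * _).
    rewrite -(bigA_distr_bigA (fun i j => A i j * B j (s i))) /=.
    by apply: eq_bigr => i _; rewrite mxE.
  apply: eq_bigr => f _; rewrite big_distrr /=; apply: eq_bigr => s _.
  rewrite big_split /= mulrCA; congr (_ * (_ * _)).
  by apply: eq_bigr => i _; rewrite mxE.
rewrite -(card_Sn m) -sumr_const.
transitivity (\sum_(s : 'S_m) \sum_(f : {ffun 'I_m -> 'I_n})
    ((-1) ^+ s * \prod_i A i (f (s i))) * \det (rowsub f B)).
  apply: eq_bigr => s _; rewrite detAB.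
  rewrite (reindex (fun f : {ffun 'I_m -> 'I_n} => [ffun i => f (s i)])) /=.
    apply: eq_bigr => f _.
    have -> : rowsub [ffun i => f (s i)] B = rowsub (f \o s) B.
      by apply/matrixP => i j; rewrite !mxE ffunE.
    rewrite det_rowsub_perm mulrA [_ * (-1) ^+ s]mulrC.
    by congr (_ * _ * _); apply: eq_bigr => i _; rewrite ffunE.
  apply: onW_bij; exists (fun f : {ffun 'I_m -> 'I_n} => [ffun i => f (s^-1 i)%g]).
    by move=> f; apply/ffunP => i; rewrite !ffunE permKV.
  by move=> f; apply/ffunP => i; rewrite !ffunE permK.
rewrite exchange_big; apply: eq_bigr => f _ /=.
rewrite -mulr_suml; congr (_ * _); apply: eq_bigr => s _.
by congr (_ * _); apply: eq_bigr => i _; rewrite mxE.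
Qed.

(** * Total positivity of products and of bordered matrices *)

Lemma injective_sort_perm m n (f : 'I_m -> 'I_n) : injective f ->
  exists s : 'S_m, {homo f \o s : i j / (i < j)%N}.
Proof.
(* The size of [below i] is the rank of [f i] among the values of [f]; the inverse of the rank
   permutation sorts [f]. *)
move=> f_inj; pose below i := [set j | (f j < f i)%N].
have below_lt i : (#|below i| < m)%N.
  rewrite -[X in (_ < X)%N]card_ord -cardsT; apply: proper_card.
  by rewrite properT; apply/negP => /eqP/setP/(_ i); rewrite !inE ltnn.
have below_mono i j : (f i < f j)%N -> (#|below i| < #|below j|)%N.
  move=> fij; apply: proper_card; apply/properP; split.
    by apply/subsetP => k; rewrite !inE => /ltn_trans; apply.
  by exists i; rewrite !inE ?ltnn.
have below_le i j : (#|below i| < #|below j|)%N -> (f i < f j)%N.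
  case: (ltngtP (f i) (f j)) => // [/below_mono|/val_inj/f_inj->].
    by move=> lt1 lt2; have:= ltn_trans lt1 lt2; rewrite ltnn.
  by rewrite ltnn.
have rank_inj : injective (fun i => Ordinal (below_lt i)).
  move=> i j /(congr1 val)/= eq_ij; apply/f_inj/val_inj.
  by case: (ltngtP (f i) (f j)) => // /below_mono; rewrite eq_ij ltnn.
exists (perm rank_inj)^-1%g => i j /= lt_ij; apply: below_le.
have rankK k : #|below ((perm rank_inj)^-1%g k)| = k.
  by have /(congr1 val) := permKV (perm rank_inj) k; rewrite permE.
by rewrite !rankK.
Qed.

(** Bounding the rows gives a parameter for induction and lets the inner sums of matrix products be
    finite; columns stay unbounded. *)
Definition totally_positive_below (R : realType) (N : nat) (A : infmx R) : Prop :=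
  forall (m : nat) (r c : 'I_m -> nat),
    {homo r : i j / (i < j)%N} -> {homo c : i j / (i < j)%N} ->
    (forall i, (r i < N)%N) -> 0 <= \det (\matrix_(i < m, j < m) A (r i) (c j)).

Lemma totally_positive_belowP (R : realType) (A : infmx R) :
  totally_positive A <-> forall N, totally_positive_below N A.
Proof.
split=> [A_tp N m r c r_mono c_mono _|A_tp m r c r_mono c_mono]; first exact: A_tp.
apply: (A_tp (\max_(i < m) r i).+1) => // i; rewrite ltnS.
exact: (leq_bigmax i).
Qed.

(** By Cauchy-Binet, [m!] times a minor of [C] is a sum over selections [f]. A repeated index gives
    two equal rows in the second factor; an injective [f] can be sorted, since the same sign appears
    in both determinants and squares to 1. *)
Lemma totally_positive_below_mul (R : realType) N (A B C : infmx R) :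
  (forall n k, (n < N)%N -> C n k = \sum_(j < N) A n j * B j k) ->
  totally_positive_below N A -> totally_positive_below N B ->
  totally_positive_below N C.
Proof.
move=> defC A_tp B_tp m r c r_mono c_mono r_lt.
pose MA := \matrix_(i < m, j < N) A (r i) j.
pose MB := \matrix_(i < N, j < m) B i (c j).
have -> : \matrix_(i < m, j < m) C (r i) (c j) = MA *m MB.
  apply/matrixP => i j; rewrite !mxE defC //.
  by apply: eq_bigr => k _; rewrite !mxE.
rewrite -(pmulrn_lge0 _ (fact_gt0 m)) Cauchy_Binet_factorial.
apply: sumr_ge0 => f _.
have [/injectiveP f_inj|/injectivePn [i [j ij fij]]] := boolP (injectiveb f);
  last first.
  rewrite [X in _ * X](determinant_alternate ij) ?mulr0 // => k.
  by rewrite !mxE fij.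
have [s fs_mono] := injective_sort_perm f_inj.
have -> : \det (colsub f MA) * \det (rowsub f MB) =
    \det (colsub (f \o s) MA) * \det (rowsub (f \o s) MB).
  by rewrite det_colsub_perm det_rowsub_perm mulrACA -expr2 sqrr_sign mul1r.
apply: mulr_ge0.
  have -> : colsub (f \o s) MA = \matrix_(i, j) A (r i) (f (s j)).
    by apply/matrixP => i j; rewrite !mxE.
  exact: A_tp.
have -> : rowsub (f \o s) MB = \matrix_(i, j) B (f (s i)) (c j).
  by apply/matrixP => i j; rewrite !mxE.
exact: B_tp.
Qed.

(** A minor of 1 (+) [A] is a minor of [A] if it avoids row 0 and column 0, vanishes if it meets
    exactly one of them, and otherwise reduces to the first case by expansion along row 0. *)
Lemma totally_positive_below_bordered (R : realType) N (A B : infmx R) :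
  B 0 0 = 1 -> (forall n, B n.+1 0 = 0) -> (forall k, B 0 k.+1 = 0) ->
  (forall n k, B n.+1 k.+1 = A n k) ->
  totally_positive_below N A -> totally_positive_below N.+1 B.
Proof.
move=> B00 Bn0 B0k BSS A_tp.
have pos m (r c : 'I_m -> nat) : {homo r : i j / (i < j)%N} ->
    {homo c : i j / (i < j)%N} -> (forall i, (r i < N.+1)%N) ->
    (forall i, 0 < r i)%N -> (forall i, 0 < c i)%N ->
    0 <= \det (\matrix_(i < m, j < m) B (r i) (c j)).
  move=> r_mono c_mono r_lt r_gt0 c_gt0.
  have -> : \matrix_(i < m, j < m) B (r i) (c j) =
      \matrix_(i, j) A (r i).-1 (c j).-1.
    by apply/matrixP => i j; rewrite !mxE -BSS !prednK.
  apply: A_tp => [i j /r_mono|i j /c_mono|i]; last by rewrite -ltnS prednK.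
    by move: (r_gt0 i); case: (r i) (r j) => [|a] [|b].
  by move: (c_gt0 i); case: (c i) (c j) => [|a] [|b].
have mono_gt0 m (r : 'I_m.+1 -> nat) : {homo r : i j / (i < j)%N} ->
    forall i, (0 < r (lift ord0 i))%N.
  by move=> r_mono i; apply: leq_ltn_trans (r_mono ord0 _ _).
case=> [|m] r c r_mono c_mono r_lt; first by rewrite det_mx00 ler01.
have gt0 (q : 'I_m.+1 -> nat) (q0 : (0 < q ord0)%N) :
    {homo q : i j / (i < j)%N} -> forall i, (0 < q i)%N.
  by move=> q_mono i; case: (unliftP ord0 i) => [j|] -> //; apply: mono_gt0.
case: (posnP (r ord0)) (posnP (c ord0)) => [r0|r0] [c0|c0]; last first.
- by apply: pos => //; apply: gt0.
- rewrite (expand_det_col _ ord0) big1 // => i _.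
  by rewrite mxE c0 -(prednK (gt0 r r0 r_mono i)) Bn0 mul0r.
- rewrite (expand_det_row _ ord0) big1 // => i _.
  by rewrite mxE r0 -(prednK (gt0 c c0 c_mono i)) B0k mul0r.
rewrite (expand_det_row _ ord0) big_ord_recl big1 => [|i _]; last first.
  by rewrite mxE r0 -(prednK (mono_gt0 m c c_mono i)) B0k mul0r.
rewrite mxE r0 c0 B00 mul1r addr0 /cofactor expr0 mul1r.
have -> : row' ord0 (col' ord0 (\matrix_(i, j) B (r i) (c j))) =
    \matrix_(i, j) B (r (lift ord0 i)) (c (lift ord0 j)).
  by apply/matrixP => i j; rewrite !mxE.
by apply: pos => //; [move=> i j ij; apply: r_mono|move=> i j ij; apply: c_mono
  |exact: mono_gt0|exact: mono_gt0].
Qed.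

(** * Formal power series and their Toeplitz matrices *)

Section PowerSeries.
Variable R : realType.
Implicit Types a b c : fps R.

(** Truncation to polynomials transfers commutativity and associativity from the polynomial ring. *)
Lemma fps_mul_coefM a b N n : (n < N)%N ->
  fps_mul a b n = ((\poly_(i < N) a i) * (\poly_(i < N) b i))`_n.
Proof.
move=> nN; rewrite coefM; apply: eq_bigr => i _; rewrite !coef_poly.
by rewrite (leq_ltn_trans _ nN) ?(leq_ltn_trans _ nN) ?leq_subr // -ltnS.
Qed.

Lemma fps_mulC : commutative (@fps_mul R).
Proof.
by move=> a b; apply/funext => n; rewrite !(fps_mul_coefM _ _ (ltnSn n)) mulrC.
Qed.

Lemma fps_mul1 : left_id (@fps_one R) (@fps_mul R).
Proof.
move=> a; apply/funext => n; rewrite /fps_mul big_ord_recl big1 => [|i _].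
  by rewrite /fps_one eqxx mul1r subn0 addr0.
by rewrite /fps_one mul0r.
Qed.

Lemma fps_mulA : associative (@fps_mul R).
Proof.
have mulE a b c n : fps_mul (fps_mul a b) c n =
   ((\poly_(i < n.+1) a i) * (\poly_(i < n.+1) b i) * (\poly_(i < n.+1) c i))`_n.
  rewrite coefM; apply: eq_bigr => i _.
  by rewrite (fps_mul_coefM _ _ (ltn_ord i)) coef_poly ltnS leq_subr.
move=> a b c; apply/funext => n.
by rewrite fps_mulC !mulE mulrC mulrA.
Qed.

HB.instance Definition _ :=
  Monoid.isComLaw.Build (fps R) (@fps_one R) (@fps_mul R)
    fps_mulA fps_mulC fps_mul1.

Lemma fps_expE a m :
  fps_exp a m = \big[@fps_mul R/@fps_one R]_(s < m) a.
Proof. by rewrite big_const_ord. Qed.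

Lemma toeplitz_mul a b N n k : (n < N)%N ->
  toeplitz (fps_mul a b) n k = \sum_(j < N) toeplitz a n j * toeplitz b j k.
Proof.
move=> nN; rewrite -(big_mkord predT (fun j => toeplitz a n j * toeplitz b j k)).
(* By lower triangularity the terms with [j > n] vanish through [a] and those with [j < k] through
   [b]; the rest is the convolution at [n - k]. *)
rewrite (big_cat_nat (leq0n n.+1) nN) /= [X in _ + X]big_nat [X in _ + X]big1.
  rewrite addr0 {1}/toeplitz; case: leqP => [kn|nk].
    rewrite (big_cat_nat (leq0n k) (leqW kn)) /= big_nat big1 => [|j /andP[_ jk]].
      rewrite add0r -[X in index_iota X]add0n big_addn big_mkord subSn // fps_mulC.
      apply: eq_bigr => i _; rewrite /toeplitz leq_addl addnK mulrC.
      have ik : (i + k <= n)%N by rewrite addnC -leq_subRL // -ltnS.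
      by rewrite ik subnDA subnAC.
    by rewrite /toeplitz [(k <= j)%N]leqNgt jk mulr0.
  rewrite big_nat big1 // => j /andP[_ jn].
  by rewrite /toeplitz [(k <= j)%N]leqNgt (leq_ltn_trans _ nk) ?mulr0.
by move=> j /andP[nj _]; rewrite /toeplitz leqNgt nj mul0r.
Qed.

(* t^k a(t^l) *)
Definition fps_spread (l k : nat) a : fps R :=
  fun m => if (k <= m)%N && (l %| m - k)%N then a ((m - k) %/ l)%N else 0.

Lemma fps_mul_spreadl l j a b n : (0 < l)%N ->
  fps_mul (fps_spread l j a) b n =
  \sum_(u < n.+1 | (j + u * l <= n)%N) a u * b (n - (j + u * l))%N.
Proof.
move=> l_gt0.
(* Since [l > 0], at most one [u] satisfies [i = j + u * l]; writing the coefficient as a sum over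
   [u] allows the two summations to be exchanged. *)
have spreadE (i : 'I_n.+1) :
    fps_spread l j a i = \sum_(u < n.+1) if i == (j + u * l)%N :> nat then a u else 0.
  rewrite /fps_spread; case: ifP => [/andP[ji /dvdnP[q iE]]|iF].
    have iE' : i = (j + q * l)%N :> nat by rewrite -iE subnKC.
    have qn : (q < n.+1)%N.
      apply: leq_ltn_trans (ltn_ord i); rewrite iE'.
      by apply: leq_trans (leq_addl _ _); rewrite leq_pmulr.
    rewrite iE mulnK // (bigD1 (Ordinal qn)) //= iE' eqxx big1 ?addr0 // => u.
    rewrite -val_eqE /= eqn_add2l eqn_pmul2r // eq_sym => /negPf.
    by move=> ->.
  rewrite big1 // => u _; case: eqP => // iE; move: iF.
  by rewrite iE leq_addr addKn dvdn_mull.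
rewrite /fps_mul; under eq_bigr do rewrite spreadE mulr_suml.
rewrite exchange_big [RHS]big_mkcond; apply: eq_bigr => u _ /=.
case: leqP => [le_n|lt_n].
  rewrite (bigD1 (Ordinal (le_n : (_ < n.+1)%N))) //= eqxx big1 ?addr0 // => i.
  by rewrite -val_eqE /= => /negPf->; rewrite mul0r.
rewrite big1 // => i _; case: eqP => [iE|]; last by rewrite mul0r.
by have := ltn_ord i; rewrite iE ltnS leqNgt lt_n.
Qed.

Lemma fps_spread_mul l j k a b : (0 < l)%N ->
  fps_mul (fps_spread l j a) (fps_spread l k b) =
  fps_spread l (j + k) (fps_mul a b).
Proof.
move=> l_gt0; apply/funext => n; rewrite fps_mul_spreadl // {2}/fps_spread.
case: ifP => [/andP[jkn /dvdnP[q nE]]|nF].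
  have {}nE : n = (j + k + q * l)%N by rewrite -nE subnKC.
  rewrite {}nE {n jkn} addKn mulnK // /fps_mul.
  have qn : (q < (j + k + q * l).+1)%N.
    by rewrite ltnS; apply: leq_trans (leq_addl _ _); rewrite leq_pmulr.
  rewrite (big_ord_widen _ (fun i => a i * b (q - i)%N) qn).
  rewrite big_mkcond [RHS]big_mkcond; apply: eq_bigr => -[u /= _] _.
  rewrite ltnS -addnA leq_add2l subnDl /fps_spread.
  case: (leqP u q) => [uq|qu].
    have -> : (k + q * l = u * l + (k + (q - u) * l))%N.
      by rewrite addnCA -mulnDl subnKC.
    by rewrite leq_addr addKn leq_addr addKn dvdn_mull // mulnK.
  (* For [u > q] the degree left to the second factor is below [k], where its coefficients are 0. *)
  case: leqP => // ukq; case: ifP => [/andP[kle _]|_]; last by rewrite mulr0.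
  have : (u * l <= q * l)%N.
    by rewrite -(leq_add2r k) [(q * l + k)%N]addnC -leq_subRL.
  by rewrite leq_pmul2r // leqNgt qu.
(* Here [n] is not of the form [j + k + q * l], so no term has both indices in the supports. *)
rewrite big1 // => -[u /= _] jun; rewrite /fps_spread.
case: ifP => [/andP[kle /dvdnP[q qE]]|_]; last by rewrite mulr0.
have nE : n = (j + k + (u + q) * l)%N.
  by rewrite -(subnKC jun) -(subnKC kle) qE mulnDl addnACA addnA.
by move: nF; rewrite nE leq_addr addKn dvdn_mull.
Qed.

Lemma fps_one_spread l : (0 < l)%N -> @fps_one R = fps_spread l 0 (@fps_one R).
Proof.
move=> l_gt0; apply/funext => n; rewrite /fps_spread /fps_one leq0n subn0 /=.
case: ifP => [/dvdnP[q ->]|ndv]; first by rewrite mulnK // muln_eq0 (gtn_eqF l_gt0) orbF.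
by case: n ndv; rewrite ?dvdn0.
Qed.

End PowerSeries.

(** * Column products and the compression *)

Lemma totally_positive_below_toeplitz_prod (R : realType) N (h : nat -> fps R) :
  (forall s, totally_positive (toeplitz (h s))) ->
  totally_positive_below N
    (fun n k => toeplitz (\big[@fps_mul R/@fps_one R]_(s < k) h s) n k).
Proof.
elim: N h => [|N IHN] h h_tp.
  case=> [|m] r c _ _ r_lt; first by rewrite det_mx00 ler01.
  by have := r_lt ord0.
(* What remains after deleting row 0 and column 0: the difference of the indices is unchanged, but
   column [k] now has [k.+1] factors, all containing [h 0]. *)
pose A : infmx R := fun n k =>
  toeplitz (\big[@fps_mul R/@fps_one R]_(s < k.+1) h s) n k.
apply: (@totally_positive_below_bordered _ _ A) => [|n|k|n k|].
- by rewrite big_ord0.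
- by rewrite big_ord0.
- by [].
- by rewrite /A /toeplitz ltnS subSS.
apply: (totally_positive_below_mul (A := toeplitz (h 0%N))); last first.
- exact: (IHN (fun s => h s.+1)).
- by have /totally_positive_belowP := h_tp 0%N.
by move=> n k nN; rewrite /A big_ord_recl (toeplitz_mul _ _ _ nN).
Qed.

Lemma divn_shiftS l k (i : 'I_l) :
  ((k.+1 + l - i.+1) %/ l = (k + l - i.+1) %/ l + (i == k %% l :> nat))%N.
Proof.
have l_gt0 : (0 < l)%N by apply: leq_ltn_trans (ltn_ord i).
have il : (i <= k + l)%N by rewrite (leq_trans (ltnW (ltn_ord i))) ?leq_addl.
(* The quotient jumps exactly when [l] divides [k + l - i], so passing from [k] to [k.+1] raises
   only the exponent with index [k %% l]. *)
have -> : (i == (k %% l)%N :> nat) = (l %| k + l - i)%N.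
  by rewrite -(eqn_mod_dvd _ il) modnDr (modn_small (ltn_ord i)) eq_sym.
have kli : (k + l - i = (k + l - i.+1).+1)%N.
  by rewrite subnS prednK // subn_gt0 (leq_trans (ltn_ord i)) ?leq_addl.
by rewrite addSn subSS kli divnS // addnC.
Qed.

Lemma prod_cyclic (T : Type) (idx : T) (op : Monoid.com_law idx) l
    (l_gt0 : (0 < l)%N) (f : 'I_l -> T) k :
  \big[op/idx]_(i < l) \big[op/idx]_(s < (k + l - i.+1) %/ l) f i =
  \big[op/idx]_(s < k) f (Ordinal (ltn_pmod s l_gt0)).
Proof.
elim: k => [|k IHk].
  rewrite big_ord0 big1 // => i _.
  by rewrite add0n divn_small ?big_ord0 // ltn_subrL.
rewrite big_ord_recr /= -IHk.
(* The new factor becomes a product over all [i] that is trivial except at [k %% l], so that it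
   merges with the product of powers. *)
rewrite -[f (Ordinal _)](big_pred1_eq op) big_mkcond -big_split /=.
apply: eq_bigr => i _; rewrite divn_shiftS -val_eqE /=.
by case: eqP => _; rewrite ?addn1 ?addn0 ?big_ord_recr ?Monoid.mulm1.
Qed.

Lemma fps_spread_prod (R : realType) l (h : nat -> fps R) k : (0 < l)%N ->
  \big[@fps_mul R/@fps_one R]_(s < k) fps_spread l 1 (h s) =
  fps_spread l k (\big[@fps_mul R/@fps_one R]_(s < k) h s).
Proof.
move=> l_gt0; elim: k => [|k IHk]; first by rewrite !big_ord0 -fps_one_spread.
by rewrite !big_ord_recr /= IHk fps_spread_mul // addn1.
Qed.

(** Division by t moves every chosen row down by one in the Toeplitz matrix of [a]; the entries just
    above the diagonal agree because [a 0 = 0]. *)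
Lemma toeplitz_totally_positive_shift (R : realType) (a : fps R) : a 0%N = 0 ->
  totally_positive (toeplitz a) -> totally_positive (toeplitz (fun n => a n.+1)).
Proof.
move=> a0 a_tp m r c r_mono c_mono.
have -> : \matrix_(i < m, j < m) toeplitz (fun n => a n.+1) (r i) (c j) =
    \matrix_(i, j) toeplitz a (r i).+1 (c j).
  apply/matrixP => i j; rewrite !mxE /toeplitz.
  case: (ltngtP (c j) (r i).+1) => [cr|rc|->]; first by rewrite -ltnS cr subSn.
    by rewrite leqNgt -ltnS ltnW.
  by rewrite ltnn subnn a0.
by apply: a_tp => // i j /r_mono.
Qed.

Theorem theorem6p4 (R : realType) (l : nat) (g : fps R) (f : 'I_l -> fps R)
    (hl : (2 <= l)%N)
    (hgf : multiple_riordan g f)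
    (hg : polya_frequency (compress_g l g))
    (hf : forall i : 'I_l, polya_frequency (compress_f l (f i))) :
  totally_positive (compression g f).
Proof.
have l_gt0 : (0 < l)%N by apply: ltnW.
case: hgf => _ g_supp _ f_supp; case: hg => _ g_tp.
(* The compression of f_i divided by t, extended periodically in the index. *)
pose h s : fps R := fun n => f (Ordinal (ltn_pmod s l_gt0)) (n * l + 1)%N.
have h_tp s : totally_positive (toeplitz (h s)).
  case: (hf (Ordinal (ltn_pmod s l_gt0))) => _.
  exact: toeplitz_totally_positive_shift.
(* The support conditions make [g] and the [f i] recoverable from their compressions, so the entries
   can be computed with spread series. *)
have gE : g = fps_spread l 0 (compress_g l g).
  apply/funext => n; rewrite /fps_spread leq0n subn0 /compress_g /=.
  by case: ifP => [/divnK->|/negbT/g_supp].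
have fE s : f (Ordinal (ltn_pmod s l_gt0)) = fps_spread l 1 (h s).
  apply/funext => n; rewrite /fps_spread /h.
  case: ifP => [/andP[n_gt0 /divnK->]|]; first by rewrite subnK.
  case: n => [|n] /= nF; apply: f_supp; first by rewrite mod0n modn_small.
  by rewrite eqn_mod_dvd // subn1 /= -[n]subn0 -subSS nF.
pose P k := \big[@fps_mul R/@fps_one R]_(s < k) h s.
have entryE n k : compression g f n k = toeplitz (fps_mul (compress_g l g) (P k)) n k.
  rewrite /compression /toeplitz; case: leqP => // kn.
  rewrite /riordan_entry.
  under [X in fps_mul g X]eq_bigr do rewrite fps_expE.
  rewrite prod_cyclic.
  under [X in fps_mul g X]eq_bigr do rewrite fE.
  rewrite fps_spread_prod // [in LHS]gE fps_spread_mul // add0n.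
  (* With this form of the degree, the coefficient of the spread product, which is t^k times a
     series in t^l, is the coefficient of index [n - k] of that series. *)
  have -> : (n * l - (l - 1) * k = k + (n - k) * l)%N.
    rewrite mulnBl mul1n [(l * k)%N]mulnC mulnBl subnBA ?leq_pmulr //.
    by rewrite addnC addnBA // leq_mul2r kn orbT.
  by rewrite /fps_spread leq_addr addKn dvdn_mull // mulnK.
apply/totally_positive_belowP => N.
apply: (totally_positive_below_mul (A := toeplitz (compress_g l g))
  (B := fun j k => toeplitz (P k) j k)).
- by move=> n k nN; rewrite entryE; apply: toeplitz_mul.
- by move/totally_positive_belowP: g_tp.
exact: (totally_positive_below_toeplitz_prod h_tp).
Qed.
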